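(* Let $\mathbf{s}^*(p)$, $p\in\mathcal{X}_{feas}$, be the solution manifold of the parametric nonlinear program $\mathcal{P}(p)$, and let $\hat{\mathbf{s}}(p)$ be the piecewise linear inexact manifold obtained around the exact solutions $\mathbf{s}^*(p_i)$, $i=1,\dots,N_s$, by means of the tangential predictor, where the sizes $\|\Delta p_i\|$ of the regions around the $p_i$ are chosen such that the active constraint set remains the same on each region and such that $\hat{\mathbf{s}}(p)$ exists for all $p\in\mathcal{X}_{feas}$. Let $\pi(p;\theta)$ be a parametric function with sufficiently rich parametrization: there exist parameters $\theta^*$ and $\hat\theta$ such that $\mathbf{s}^*(p)=\pi(p;\theta^* )$ and $\hat{\mathbf{s}}(p)=\pi(p;\hat\theta)$ for all $p\in\mathcal{X}_{feas}$. For $M$ samples, let $$\theta_1=\arg\min_\theta\sum_{k=1}^{M}\|\pi(p_k;\theta)-\mathbf{s}^*(p_k)\|^2,\qquad \theta_2=\arg\min_\theta\sum_{k=1}^{M}\|\pi(p_k;\theta)-\hat{\mathbf{s}}(p_k)\|^2,$$ and suppose that $\theta_1$ and $\theta_2$ are consistent estimators (of $\theta^*$ and $\hat\theta$, respectively). Then, for every $p\in\mathcal{X}_{feas}$, $$\|\pi(p;\theta_1)-\pi(p;\theta_2)\|\le D\quad\text{in probability as } M\to\infty,$$ where $D:=\max\left(\left\{L_{p_i}\|\Delta p_i\|^2\right\}_{i=1}^{N_s}\right)$.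
   Context: Parametric NLP: for a parameter $p\in\mathbb{R}^{n_x}$, $\mathcal{P}(p)$ is the problem $V_N(p)=\min_{\mathbf{w}} J(\mathbf{w},p)$ subject to $c(\mathbf{w},p)=0$, $g(\mathbf{w},p)\le 0$. Its Lagrangian is $\mathcal{L}(\mathbf{w},p,\lambda,\mu)=J(\mathbf{w},p)+\lambda^{\mathsf T}c(\mathbf{w},p)+\mu^{\mathsf T}g(\mathbf{w},p)$. A KKT point for $p$ is a primal-dual vector $\mathbf{s}^*(p)=[\mathbf{w}^*,\lambda^*,\mu^*]^{\mathsf T}$ with $\nabla_{\mathbf{w}}\mathcal{L}=0$, $c=0$, $g\le 0$, $\mu_j g_j=0$ and $\mu_j\ge 0$ for all $j$. The active inequality constraints $g_{\mathbb{A}}$ are the components of $g$ equal to $0$ at the solution. $\mathcal{X}_{feas}\subseteq\mathbb{R}^{n_x}$ is the feasible set of parameters (initial states), and $p\mapsto\mathbf{s}^*(p)$ denotes the optimal primal-dual solution of $\mathcal{P}(p)$ for $p\in\mathcal{X}_{feas}$ (the solution manifold). Standing regularity: at each base point $p_i\in\mathcal{X}_{feas}$, $i=1,\dots,N_s$, the functions $J,c,g$ are twice continuously differentiable in a neighborhood of the KKT point $\mathbf{s}^*(p_i)$, and the linear independence constraint qualification (LICQ), the second order sufficient conditions (SOSC) and strict complementarity (SC: multipliers of active inequality constraints are $>0$) hold at $\mathbf{s}^*(p_i)$. Tangential predictor: at $p_i$ set $$\mathcal{M}_i=\begin{bmatrix}\nabla^2_{\mathbf{w}\mathbf{w}}\mathcal{L}&\nabla_{\mathbf{w}}c&\nabla_{\mathbf{w}}g_{\mathbb{A}}\\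 \nabla_{\mathbf{w}}c^{\mathsf T}&0&0\\ \nabla_{\mathbf{w}}g_{\mathbb{A}}^{\mathsf T}&0&0\end{bmatrix},\qquad \mathcal{N}_i=\begin{bmatrix}\nabla^2_{\mathbf{w}p}\mathcal{L}\\ \nabla_p c^{\mathsf T}\\ \nabla_p g_{\mathbb{A}}^{\mathsf T}\end{bmatrix},$$ evaluated at $\mathbf{s}^*(p_i)$ and $p_i$. The predictor is $\hat{\mathbf{s}}^*(p_i+\Delta p)=\mathbf{s}^*(p_i)-\mathcal{M}_i^{-1}\mathcal{N}_i\Delta p$ (multipliers of inactive constraints are kept equal to $0$). Piecewise linear inexact manifold: around each $p_i$ one takes a region $R_i\subseteq\mathcal{X}_{feas}$ containing $p_i$. The size $\|\Delta p_i\|>0$ of $R_i$ is the maximal norm of the perturbations allowed around $p_i$, so that $\|p-p_i\|\le\|\Delta p_i\|$ for $p\in R_i$. The regions $R_1,\dots,R_{N_s}$ cover $\mathcal{X}_{feas}$, each $p\in\mathcal{X}_{feas}$ being assigned to one region. The active constraint set at $\mathbf{s}^*(p)$ is the same for all $p\in R_i$. For $p$ assigned to $R_i$, $\hat{\mathbf{s}}(p)=\mathbf{s}^*(p_i)-\mathcal{M}_i^{-1}\mathcal{N}_i(p-p_i)$. The $L_{p_i}$ are positive constants for which the bound $\|\hat{\mathbf{s}}(p)-\mathbf{s}^*(p)\|\le\max(\{L_{p_i}\|\Delta p_i\|^2\}_{i=1}^{N_s})$ holds for all $p\in\mathcal{X}_{feas}$. Estimation: $M=N_sN_p$ training points $p_k\in\mathcal{X}_{feas}$,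 $k=1,\dots,M$, are sampled (randomly), with the same points used for $\theta_1$ and $\theta_2$; $N_s$ and the manifold $\hat{\mathbf{s}}$ are fixed while $M\to\infty$. Thus $\theta_1=\theta_1^{(M)}$ and $\theta_2=\theta_2^{(M)}$ are random and depend on $M$. Consistency, as the paper writes it, means $\lim_{M\to\infty}\mathbb{P}(|\theta_1-\theta^*|>\epsilon)=0$ and $\lim_{M\to\infty}\mathbb{P}(|\theta_2-\hat\theta|>\epsilon)=0$ for any $\epsilon\ge 0$. A bound $\|X_M\|\le D$ ''in probability as $M\to\infty$'' means $\lim_{M\to\infty}\mathbb{P}(\|X_M\|>D)=0$. *)

(* Defs.v *)
From HB Require Import structures.
From mathcomp Require Import all_boot all_order all_algebra.
From mathcomp Require Import all_classical all_reals all_analysis.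

Set Implicit Arguments.
Unset Strict Implicit.
Unset Printing Implicit Defensive.
Import Order.TTheory GRing.Theory Num.Theory.
Import numFieldNormedType.Exports.

Local Open Scope classical_set_scope.
Local Open Scope ring_scope.

(* Vectors of R^n are row vectors, because the library Jacobian 'J is defined
   for maps 'rV_n -> 'rV_m. The entry ('J f x) i j is the partial derivative of
   the j-th component of f along the i-th coordinate, so 'J f x is the n x m
   matrix usually written nabla f(x), with the component gradients as columns. *)

Section Calculus.
Context {R : realType}.

(* The library norm `|v| on 'rV_n is the max norm. *)
Definition enorm n (v : 'rV[R]_n) : R := Num.sqrt (\sum_i v 0 i ^+ 2).

Definition grad n (f : 'rV[R]_n -> R) (x : 'rV[R]_n) : 'rV[R]_n :=
  \row_i 'D_(delta_mx 0 i) (f : 'rV[R]_n -> R^o) x.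

Definition C2_near (V W : normedModType R) (f : V -> W) (x0 : V) : Prop :=
  \forall x \near x0,
    differentiable f x /\
    forall u : V, differentiable ('D_u f) x /\
      forall v : V, {for x, continuous ('D_v ('D_u f))}.

End Calculus.

(* minimize objective w p over w
   subject to eq_constr w p = 0 and ineq_constr w p <= 0 (componentwise) *)
Record pnlp (R : realType) (nw np nc ng : nat) := PNLP {
  objective : 'rV[R]_nw -> 'rV[R]_np -> R ;
  eq_constr : 'rV[R]_nw -> 'rV[R]_np -> 'rV[R]_nc ;
  ineq_constr : 'rV[R]_nw -> 'rV[R]_np -> 'rV[R]_ng }.

Section ParametricNLP.
Context {R : realType} {nw np nc ng : nat} (Q : pnlp R nw np nc ng).

Notation primal_dual := 'rV[R]_(nw + (nc + ng)).

Definition primal (s : primal_dual) : 'rV[R]_nw := lsubmx s.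
Definition eq_mult (s : primal_dual) : 'rV[R]_nc := lsubmx (rsubmx s).
Definition ineq_mult (s : primal_dual) : 'rV[R]_ng := rsubmx (rsubmx s).

Definition feasible (w : 'rV[R]_nw) (p : 'rV[R]_np) : Prop :=
  eq_constr Q w p = 0 /\ forall j, ineq_constr Q w p 0 j <= 0.

Definition Xfeas : set 'rV[R]_np := [set p | exists w, feasible w p].

Definition lagrangian (w : 'rV[R]_nw) (p : 'rV[R]_np)
    (lambda : 'rV[R]_nc) (mu : 'rV[R]_ng) : R :=
  objective Q w p + \sum_j lambda 0 j * eq_constr Q w p 0 j
                  + \sum_j mu 0 j * ineq_constr Q w p 0 j.

Definition KKT_point (p : 'rV[R]_np) (s : primal_dual) : Prop :=
  let w := primal s in
  let L := fun w' : 'rV[R]_nw =>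
    lagrangian w' p (eq_mult s) (ineq_mult s) : R^o in
  [/\ differentiable L w /\ grad L w = 0,
      feasible w p,
      forall j, ineq_mult s 0 j * ineq_constr Q w p 0 j = 0 &
      forall j, 0 <= ineq_mult s 0 j].

Definition optimal_primal_dual (p : 'rV[R]_np) (s : primal_dual) : Prop :=
  (forall w, feasible w p -> objective Q (primal s) p <= objective Q w p) /\
  KKT_point p s.

Definition active (p : 'rV[R]_np) (s : primal_dual) : {set 'I_ng} :=
  finset (fun j => ineq_constr Q (primal s) p 0 j == 0).

Definition grad_w_eq (p : 'rV[R]_np) (s : primal_dual) : 'M[R]_(nw, nc) :=
  'J (fun w => eq_constr Q w p) (primal s).

Definition grad_w_ineq (p : 'rV[R]_np) (s : primal_dual) : 'M[R]_(nw, ng) :=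
  'J (fun w => ineq_constr Q w p) (primal s).

Definition grad_p_eq (p : 'rV[R]_np) (s : primal_dual) : 'M[R]_(np, nc) :=
  'J (fun p' => eq_constr Q (primal s) p') p.

Definition grad_p_ineq (p : 'rV[R]_np) (s : primal_dual) : 'M[R]_(np, ng) :=
  'J (fun p' => ineq_constr Q (primal s) p') p.

Definition grad_w_lagrangian (s : primal_dual) (w : 'rV[R]_nw)
    (p : 'rV[R]_np) : 'rV[R]_nw :=
  grad (fun w' => lagrangian w' p (eq_mult s) (ineq_mult s)) w.

Definition hess_ww (p : 'rV[R]_np) (s : primal_dual) : 'M[R]_nw :=
  'J (fun w => grad_w_lagrangian s w p) (primal s).

(* entry (i, j) is the second derivative of the Lagrangian in w_i and p_j *)
Definition hess_wp (p : 'rV[R]_np) (s : primal_dual) : 'M[R]_(nw, np) :=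
  ('J (fun p' => grad_w_lagrangian s (primal s) p') p)^T.

Definition act_cols (A : {set 'I_ng}) m (G : 'M[R]_(m, ng)) : 'M[R]_(m, #|A|) :=
  colsub (fun k : 'I_#|A| => enum_val k) G.

Definition grad_w_active (p : 'rV[R]_np) (s : primal_dual) :
    'M[R]_(nw, nc + #|active p s|) :=
  row_mx (grad_w_eq p s) (act_cols (active p s) (grad_w_ineq p s)).

Definition grad_p_active (p : 'rV[R]_np) (s : primal_dual) :
    'M[R]_(np, nc + #|active p s|) :=
  row_mx (grad_p_eq p s) (act_cols (active p s) (grad_p_ineq p s)).

Definition LICQ (p : 'rV[R]_np) (s : primal_dual) : Prop :=
  row_free (grad_w_active p s)^T.

Definition critical_cone (p : 'rV[R]_np) (s : primal_dual) :
    set 'rV[R]_nw :=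
  [set v | [/\ v *m grad_w_eq p s = 0,
      forall j, j \in active p s -> 0 < ineq_mult s 0 j ->
        (v *m grad_w_ineq p s) 0 j = 0 &
      forall j, j \in active p s -> ineq_mult s 0 j = 0 ->
        (v *m grad_w_ineq p s) 0 j <= 0]].

Definition SOSC (p : 'rV[R]_np) (s : primal_dual) : Prop :=
  forall v, critical_cone p s v -> v != 0 ->
    0 < (v *m hess_ww p s *m v^T) 0 0.

Definition strict_complementarity (p : 'rV[R]_np) (s : primal_dual) : Prop :=
  forall j, j \in active p s -> 0 < ineq_mult s 0 j.

Definition C2_data (p : 'rV[R]_np) (s : primal_dual) : Prop :=
  let z : 'rV[R]_nw * 'rV[R]_np := (primal s, p) in
  [/\ C2_near (fun x => objective Q x.1 x.2 : R^o) z,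
      C2_near (fun x => eq_constr Q x.1 x.2) z &
      C2_near (fun x => ineq_constr Q x.1 x.2) z].

Definition regular_at (p : 'rV[R]_np) (s : primal_dual) : Prop :=
  [/\ C2_data p s, LICQ p s, SOSC p s & strict_complementarity p s].

Definition KKT_matrix (p : 'rV[R]_np) (s : primal_dual) :
    'M[R]_(nw + (nc + #|active p s|)) :=
  block_mx (hess_ww p s)         (grad_w_active p s)
           (grad_w_active p s)^T 0.

Definition param_matrix (p : 'rV[R]_np) (s : primal_dual) :
    'M[R]_(nw + (nc + #|active p s|), np) :=
  col_mx (hess_wp p s) (grad_p_active p s)^T.

(* The correction M^-1 N dp only has components for the active multipliers;
   it is padded with zeros at the inactive ones. Complementarity makes these
   multipliers vanish in s, hence also in the prediction. *)
Definition predictor (p : 'rV[R]_np) (s : primal_dual) (dp : 'rV[R]_np) :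
    primal_dual :=
  let y := (invmx (KKT_matrix p s) *m param_matrix p s *m dp^T)^T in
  let y_mu := rsubmx (rsubmx y) in
  let pad := rowsub (fun k : 'I_#|active p s| => enum_val k) 1%:M in
  s - row_mx (lsubmx y) (row_mx (lsubmx (rsubmx y)) (y_mu *m pad)).

Definition inexact_manifold (sol : 'rV[R]_np -> primal_dual) (Ns : nat)
    (base : 'I_Ns -> 'rV[R]_np) (region_of : 'rV[R]_np -> 'I_Ns)
    (p : 'rV[R]_np) : primal_dual :=
  let b := base (region_of p) in predictor b (sol b) (p - b).

End ParametricNLP.

Section Estimation.
Context {R : realType}.

Definition max_error_bound (Ns : nat) (L radius : 'I_Ns -> R) : R :=
  \big[Num.max/0]_(i < Ns) (L i * radius i ^+ 2).

Definition squared_loss (np nt ns M : nat)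
    (pol : 'rV[R]_np -> 'rV[R]_nt -> 'rV[R]_ns) (target : 'rV[R]_np -> 'rV[R]_ns)
    (sample : 'I_M -> 'rV[R]_np) (theta : 'rV[R]_nt) : R :=
  \sum_(k < M) enorm (pol (sample k) theta - target (sample k)) ^+ 2.

Definition is_argmin (X : Type) (f : X -> R) (x : X) : Prop :=
  forall y, f x <= f y.

Context {d : measure_display} {T : measurableType d} (P : probability T R).

Definition random_vector n (X : T -> 'rV[R]_n) : Prop :=
  forall i, measurable_fun setT (fun om => X om 0 i).

(* eps = 0 is included *)
Definition consistent n (X : nat -> T -> 'rV[R]_n) (x : 'rV[R]_n) : Prop :=
  forall eps : R, 0 <= eps ->
    P [set om | eps < enorm (X N om - x)] @[N --> \oo] --> 0%E.

Definition bounded_in_probability n (X : nat -> T -> 'rV[R]_n) (D : R) : Prop :=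
  P [set om | D < enorm (X N om)] @[N --> \oo] --> 0%E.

End Estimation.

(* Main.v *)
Require Import Defs.
From HB Require Import structures.
From mathcomp Require Import all_boot all_order all_algebra.
From mathcomp Require Import all_classical all_reals all_analysis measurable_realfun.

Set Implicit Arguments.
Unset Strict Implicit.
Unset Printing Implicit Defensive.
Import Order.TTheory GRing.Theory Num.Theory.
Import numFieldNormedType.Exports.

Local Open Scope classical_set_scope.
Local Open Scope ring_scope.

(** The consistency hypothesis includes the tolerance [eps = 0]: it says that
    the probability of the event [theta1 <> theta_star] tends to [0], and
    likewise for [theta2] and [theta_hat]. Outside these two events the
    estimated policies are exactly the two manifolds, because the
    parametrization is rich enough to represent both:
      [pol p theta1 = sol p] and [pol p theta2] is the inexact manifold at [p].
    Their distance is then at most [D] by the predictor error bound. Hence the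
    event where the distance exceeds [D] is contained in the union of two events
    whose probabilities vanish, and a union bound concludes
    ([consistent_pair_bounded]). The union bound needs measurable events, which
    come from the measurability of the Euclidean norm of a random vector
    ([measurable_enorm]). *)

Section EuclideanNorm.
Context {R : realType}.

Lemma enorm_ge0 n (v : 'rV[R]_n) : 0 <= enorm v.
Proof. exact: sqrtr_ge0. Qed.

Lemma enorm0_eq0 n (v : 'rV[R]_n) : enorm v = 0 -> v = 0.
Proof.
move=> /eqP; rewrite sqrtr_eq0 => sum_le0.
have sq_ge0 i : true -> 0 <= v 0 i ^+ 2 by move=> _; exact: sqr_ge0.
have /eqP : \sum_i v 0 i ^+ 2 = 0.
  by apply/eqP; rewrite eq_le sum_le0 sumr_ge0.
rewrite psumr_eq0 // => /allP v0; apply/rowP => i; rewrite mxE.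
by apply/eqP; rewrite -sqrf_eq0; apply: v0; rewrite mem_index_enum.
Qed.

Lemma enormN n (v : 'rV[R]_n) : enorm (- v) = enorm v.
Proof.
by rewrite /enorm; congr Num.sqrt; apply: eq_bigr => i _; rewrite mxE sqrrN.
Qed.

End EuclideanNorm.

Section RandomVectors.
Context {R : realType} {d : measure_display} {T : measurableType d}.
Context (P : probability T R).

Lemma measurable_enorm n (X : T -> 'rV[R]_n) :
  random_vector X -> measurable_fun setT (fun om => enorm (X om)).
Proof.
move=> mX.
have msqrt : measurable_fun setT (@Num.sqrt R).
  by apply: continuous_measurable_fun; exact: sqrt_continuous.
apply: (measurableT_comp msqrt).
by apply: measurable_sum => i; exact: measurable_funX.
Qed.

Lemma random_vectorB n (X Y : T -> 'rV[R]_n) :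
  random_vector X -> random_vector Y -> random_vector (fun om => X om - Y om).
Proof.
move=> mX mY i; under eq_fun do rewrite !mxE.
exact: measurable_funB.
Qed.

Lemma random_vector_cst n (v : 'rV[R]_n) : random_vector (fun _ : T => v).
Proof. by move=> i; exact: measurable_cst. Qed.

Lemma measurable_enorm_gt n (X : T -> 'rV[R]_n) (a : R) :
  random_vector X -> measurable [set om | a < enorm (X om)].
Proof.
move=> mX; rewrite -[X in measurable X]setTI.
have mE : measurable_fun setT (EFin \o (fun om => enorm (X om))).
  by apply/measurable_EFinP; exact: measurable_enorm.
under eq_set do rewrite -lte_fin.
exact: (emeasurable_fun_o_infty measurableT mE a%:E).
Qed.

(** Taking the tolerance [0] in both consistency hypotheses makes [X N] equal to
    [x] and [Y N] equal to [y] with probability tending to [1], so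
    [f (X N) - g (Y N)] inherits the bound on [f x - g y] from a single point,
    where convergence with positive tolerances would call for continuity of [f]
    and [g]. *)
Lemma consistent_pair_bounded k l m (X : nat -> T -> 'rV[R]_k)
    (Y : nat -> T -> 'rV[R]_l) (f : 'rV[R]_k -> 'rV[R]_m)
    (g : 'rV[R]_l -> 'rV[R]_m) (x : 'rV[R]_k) (y : 'rV[R]_l) (D : R) :
  (forall N, random_vector (X N)) -> (forall N, random_vector (Y N)) ->
  (forall N, random_vector (fun om => f (X N om))) ->
  (forall N, random_vector (fun om => g (Y N om))) ->
  consistent P X x -> consistent P Y y -> enorm (f x - g y) <= D ->
  bounded_in_probability P (fun N om => f (X N om) - g (Y N om)) D.
Proof.
move=> mX mY mfX mgY cX cY fg_le.
pose bad n (Z : nat -> T -> 'rV[R]_n) z N := [set om | 0 < enorm (Z N om - z)].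
have mbad n (Z : nat -> T -> 'rV[R]_n) z N :
    random_vector (Z N) -> measurable (bad n Z z N).
  move=> mZ; apply: (measurable_enorm_gt (X := fun om => Z N om - z)).
  by apply: random_vectorB => //; exact: random_vector_cst.
have good n (Z : nat -> T -> 'rV[R]_n) z N om : ~ bad n Z z N om -> Z N om = z.
  move=> /negP; rewrite -leNgt => Zz_le0; apply/eqP; rewrite -subr_eq0.
  by apply/eqP/enorm0_eq0/eqP; rewrite eq_le Zz_le0 enorm_ge0.
have bad_cvg0 : (P (bad _ X x N) + P (bad _ Y y N))%E @[N --> \oo] --> 0%E.
  by rewrite -[X in _ --> X]adde0; apply: cvgeD => //; [exact: cX|exact: cY].
apply: (squeeze_cvge _ (cvg_cst 0%E) bad_cvg0).
apply: nearW => N; rewrite measure_ge0 /=.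
apply: (le_trans _ (measureU2 _ (mbad _ X x N (mX N)) (mbad _ Y y N (mY N)))).
apply: le_measure; rewrite ?inE.
- exact: measurable_enorm_gt (random_vectorB (mfX N) (mgY N)).
- by apply: measurableU; exact: mbad.
move=> om /= D_lt; apply: contrapT => /not_orP[/good Xx /good Yy].
by move: D_lt; rewrite Xx Yy ltNge fg_le.
Qed.

End RandomVectors.

Theorem theorem2 (R : realType) (nw np nc ng : nat) (Q : pnlp R nw np nc ng)
    (* exact solution manifold *)
    (sol : 'rV[R]_np -> 'rV[R]_(nw + (nc + ng)))
    (sol_opt : forall p, Xfeas Q p -> optimal_primal_dual Q p (sol p))
    (* base points, with the standing regularity *)
    (Ns : nat) (base : 'I_Ns -> 'rV[R]_np)
    (base_feas : forall i, Xfeas Q (base i))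
    (base_regular : forall i, regular_at Q (base i) (sol (base i)))
    (* regions around the base points, of size radius i, covering Xfeas *)
    (region : 'I_Ns -> set 'rV[R]_np) (radius : 'I_Ns -> R)
    (region_feas : forall i, region i `<=` Xfeas Q)
    (region_base : forall i, region i (base i))
    (radius_gt0 : forall i, 0 < radius i)
    (region_size : forall i p, region i p -> enorm (p - base i) <= radius i)
    (region_active : forall i p, region i p ->
      active Q p (sol p) = active Q (base i) (sol (base i)))
    (region_of : 'rV[R]_np -> 'I_Ns)
    (region_cover : forall p, Xfeas Q p -> region (region_of p) p)
    (* constants of the tangential predictor error bound *)
    (L : 'I_Ns -> R) (L_gt0 : forall i, 0 < L i)
    (predictor_error : forall p, Xfeas Q p ->
      enorm (inexact_manifold Q sol base region_of p - sol p)
        <= max_error_bound L radius)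
    (* sufficiently rich parametric function *)
    (nt : nat) (pol : 'rV[R]_np -> 'rV[R]_nt -> 'rV[R]_(nw + (nc + ng)))
    (theta_star theta_hat : 'rV[R]_nt)
    (pol_star : forall p, Xfeas Q p -> sol p = pol p theta_star)
    (pol_hat : forall p, Xfeas Q p ->
      inexact_manifold Q sol base region_of p = pol p theta_hat)
    (* random samples, Ns * Np of them, and the two estimators *)
    (d : measure_display) (T : measurableType d) (P : probability T R)
    (sample : forall Np : nat, 'I_(Ns * Np) -> T -> 'rV[R]_np)
    (sample_random : forall Np k, random_vector (sample Np k))
    (sample_feas : forall Np k om, Xfeas Q (sample Np k om))
    (theta1 theta2 : nat -> T -> 'rV[R]_nt)
    (theta1_random : forall Np, random_vector (theta1 Np))
    (theta2_random : forall Np, random_vector (theta2 Np))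
    (pol_theta1_random : forall p Np, Xfeas Q p ->
      random_vector (fun om => pol p (theta1 Np om)))
    (pol_theta2_random : forall p Np, Xfeas Q p ->
      random_vector (fun om => pol p (theta2 Np om)))
    (theta1_argmin : forall Np om,
      is_argmin (squared_loss pol sol (fun k => sample Np k om))
                (theta1 Np om))
    (theta2_argmin : forall Np om,
      is_argmin (squared_loss pol (inexact_manifold Q sol base region_of)
                              (fun k => sample Np k om))
                (theta2 Np om))
    (theta1_consistent : consistent P theta1 theta_star)
    (theta2_consistent : consistent P theta2 theta_hat) :
  forall p, Xfeas Q p ->
    bounded_in_probability P
      (fun Np om => pol p (theta1 Np om) - pol p (theta2 Np om))
      (max_error_bound L radius).
Proof.
move=> p p_feas; apply: (consistent_pair_bounded (f := pol p) (g := pol p)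
  theta1_random theta2_random _ _ theta1_consistent theta2_consistent).
- by move=> N; exact: pol_theta1_random.
- by move=> N; exact: pol_theta2_random.
by rewrite -pol_star // -pol_hat // -enormN opprB; exact: predictor_error.
Qed.
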